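(* Let $A$ be a discrete (finite or countably infinite) alphabet and let $X_1^n=(X_1,\ldots,X_n)$ be an exchangeable vector of random variables $X_i$ taking values in $A$. For every $1\leq k\leq n-1$ there exists a probability measure $\mu=\mu_{k,n}$ on $\mathcal{M}_1(A)$ such that $$D\big(P_{X_1^k}\,\big\|\,M_{k,\mu}\big)\leq\frac{k(k-1)}{2(n-k+1)}H(X_1)\leq\frac{k(k-1)}{2(n-k+1)}\log|A|.$$
   Context: A random vector $(X_1,\ldots,X_n)$ is exchangeable if it has the same distribution as $(X_{\pi(1)},\ldots,X_{\pi(n)})$ for every permutation $\pi$ of $\{1,\ldots,n\}$. Write $X_1^k=(X_1,\ldots,X_k)$, and $P_X$ for the law of $X$. The discrete alphabet $A$ carries the $\sigma$-algebra $\mathcal{A}$ of all its subsets. $\mathcal{M}_1(A)$ denotes the space of probability measures on $A$, equipped with the smallest $\sigma$-algebra that makes all the maps $P\mapsto P(F)$, $F\subseteq A$, measurable. For a probability measure $\mu$ on $\mathcal{M}_1(A)$ and $k\geq 1$, the mixture $M_{k,\mu}$ is the probability measure on $A^k$ given by $$M_{k,\mu}(F)=\int_{\mathcal{M}_1(A)}Q^k(F)\,d\mu(Q),\quad F\subseteq A^k,$$ where $Q^k$ is the $k$-fold product measure of $Q$. The relative entropy between probability measures $P,Q$ on the same measurable space is $D(P\|Q)=\int \log\frac{dP}{dQ}\,dP$ if $P\ll Q$, and $+\infty$ otherwise. The entropy of a random variable $X$ with probability mass function $P$ on a discrete alphabet $B$ is $H(X)=-\sum_{x\in B}P(x)\log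 P(x)\in[0,+\infty]$ (with $0\log 0=0$). $\log$ is the natural logarithm; $\log|A|=+\infty$ if $A$ is infinite, and $0\cdot\infty=0$. *)

(* Defs.v *)
From HB Require Import structures.
From mathcomp Require Import all_boot all_order all_fingroup all_algebra.
From mathcomp Require Import all_classical all_reals all_analysis.
From mathcomp Require Import measurable_realfun.

Set Implicit Arguments.
Unset Strict Implicit.
Unset Printing Implicit Defensive.

Import Order.TTheory GRing.Theory Num.Theory.
Import numFieldNormedType.Exports.

Local Open Scope classical_set_scope.
Local Open Scope ring_scope.
Local Open Scope ereal_scope.

(* The random vector (X_1, ..., X_k); it is measurable for the product
   sigma-algebra of [k.-tuple A]. *)
Section random_vector.
Context {d d'} {T : measurableType d} {A : measurableType d'} {R : realType}
  {P : probability T R}.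

Definition random_vector k (X : 'I_k -> {RV P >-> A}) : T -> k.-tuple A :=
  fun w => [tuple X i w | i < k].

Lemma measurable_random_vector k (X : 'I_k -> {RV P >-> A}) :
  measurable_fun [set: T] (random_vector X).
Proof.
apply/measurable_fun_tnthP => i.
suff -> : @tnth k A ^~ i \o random_vector X = X i by [].
by apply/funext => w /=; rewrite tnth_mktuple.
Qed.

HB.instance Definition _ k (X : 'I_k -> {RV P >-> A}) :=
  isMeasurableFun.Build _ _ _ _ (random_vector X) (measurable_random_vector X).

Definition exchangeable n (X : 'I_n -> {RV P >-> A}) : Prop :=
  forall (pi : 'S_n) (F : set (n.-tuple A)), measurable F ->
    distribution P (random_vector (fun i => X (pi i))) F =
    distribution P (random_vector X) F.

Definition initial_vars k n (le_kn : (k <= n)%N) (X : 'I_n -> {RV P >-> A}) :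
    'I_k -> {RV P >-> A} :=
  fun i => X (widen_ord le_kn i).

End random_vector.

Section product_power.
Context {d} {A : measurableType d} {R : realType}.

Definition cons_pair k (p : A * k.-tuple A) : k.+1.-tuple A :=
  [tuple of p.1 :: p.2].

Lemma measurable_cons_pair k : measurable_fun [set: _] (@cons_pair k).
Proof. exact: measurable_cons. Qed.

HB.instance Definition _ k :=
  isMeasurableFun.Build _ _ _ _ (@cons_pair k) (@measurable_cons_pair k).

(* Q^k, obtained by transporting [Q \x Q^(k-1)] along the identification of
   [A * A^(k-1)] with [A^k]. *)
Fixpoint product_power (Q : probability A R) (k : nat) :
    probability (k.-tuple A) R :=
  match k with
  | 0 => dirac [tuple]
  | k'.+1 => distribution (Q \x product_power Q k') (@cons_pair k')
  end.

Lemma product_powerS (Q : probability A R) k (F : set (k.+1.-tuple A)) :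
  product_power Q k.+1 F =
  \int[Q]_x product_power Q k (xsection (@cons_pair k @^-1` F) x).
Proof. by []. Qed.

Lemma product_power_box (Q : probability A R) k (F : 'I_k -> set A) :
  (forall i, measurable (F i)) ->
  product_power Q k [set t | forall i, F i (tnth t i)] = \prod_(i < k) Q (F i).
Proof.
elim: k F => [|k IH] F mF.
  by rewrite big_ord0 /= diracE mem_set//= => -[].
rewrite big_ord_recl -IH//.
rewrite -product_measure1E//; last first.
  rewrite [X in measurable X](_ : _ = \bigcap_(i in [set: 'I_k])
    (@tnth k A ^~ i @^-1` F (lift ord0 i))).
    apply: fin_bigcap_measurable => // i _.
    by rewrite -[X in measurable X]setTI; exact: measurable_tnth.
  by apply/seteqP; split => t /= Ft i; [move=> _|]; exact: Ft.
congr (product_measure1 _ _ _); apply/seteqP; split => -[x t] /=.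
  move=> Ft; split => [|i]; first exact: (Ft ord0).
  by have := Ft (lift ord0 i); rewrite tnthS.
by move=> [Fx Ft] i; case: (unliftP ord0 i) => [j ->|->//]; rewrite tnthS.
Qed.

Lemma measurable_product_power k (F : set (k.-tuple A)) : measurable F ->
  measurable_fun [set: pprobability A R]
    (fun Q : pprobability A R => product_power Q k F).
Proof.
elim: k F => [|k IH] F mF; first exact: measurable_cst.
pose h (z : pprobability A R * A) : {measure set (k.-tuple A) -> \bar R} :=
  product_power z.1 k.
have mh U : measurable U -> measurable_fun [set: _] (h ^~ U).
  by move=> mU; exact: (measurableT_comp (IH U mU) measurable_fst).
have h1 z : h z [set: _] = 1 by exact: probability_setT.
pose hK := isKernel.Build _ _ _ _ R h mh.
pose hP := Kernel_isProbability.Build _ _ _ _ R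
  (HB.pack_for (R.-ker _ ~> _) h hK) h1.
pose H : R.-pker (pprobability A R * A)%type ~> k.-tuple A := HB.pack h hK hP.
have mcF : measurable (@cons_pair k @^-1` F).
  by rewrite -[X in measurable X]setTI; exact: measurable_cons_pair.
have := @measurable_kproduct _ _ _ _ _ _ R
  (kprobability (@measurable_id _ (pprobability A R) setT)) H _ mcF.
apply: eq_measurable_fun => Q _.
rewrite product_powerS; apply: eq_integral => x _.
exact: (kernel.intker_indicE H).
Qed.

End product_power.

Section mixture.
Context {d} {A : measurableType d} {R : realType}.
Variables (k : nat) (mu : probability (pprobability A R) R).

Definition mixture (F : set (k.-tuple A)) : \bar R :=
  \int[mu]_Q product_power Q k F.

Let mixture0 : mixture set0 = 0.
Proof. by rewrite /mixture; apply: integral0_eq => Q _; rewrite measure0. Qed.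

Let mixture_ge0 F : 0 <= mixture F.
Proof. exact: integral_ge0. Qed.

Let mixture_sigma_additive : semi_sigma_additive mixture.
Proof.
move=> F mF tF mUF; rewrite [X in _ --> X](_ : _ = \sum_(n <oo) mixture (F n)).
  by apply/cvg_closeP; split; [exact: is_cvg_nneseries|rewrite closeE].
rewrite -integral_nneseries//; last by move=> n; exact: measurable_product_power.
apply: eq_integral => Q _; apply/esym/cvg_lim => //.
exact: measure_semi_sigma_additive.
Qed.

HB.instance Definition _ := isMeasure.Build _ _ _ mixture
  mixture0 mixture_ge0 mixture_sigma_additive.

Let mixture_setT : mixture [set: _] = 1.
Proof.
transitivity (\int[mu]_Q cst 1 Q).
  by apply: eq_integral => Q _; exact: probability_setT.
by rewrite integral_cst// mul1e; exact: probability_setT.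
Qed.

HB.instance Definition _ := Measure_isProbability.Build _ _ _
  mixture mixture_setT.

End mixture.
Arguments mixture {d A R} k mu F.

Local Open Scope charge_scope.

Section information.
Context {d} {B : measurableType d} {R : realType}.

Definition relative_entropy (P Q : probability B R) : \bar R :=
  if `[< P `<< Q >] then
    \int[P]_x lne (('d (charge_of_finite_measure P) '/d Q) x)
  else +oo.

(* [lne 0 = -oo] and [0 * -oo = 0], hence the convention [0 log 0 = 0]. The
   minus sign is inside the sum because [\esum] is the supremum of the finite
   partial sums, which is meant for nonnegative terms. *)
Definition entropy {d'} {T : measurableType d'} {P : probability T R}
    (X : {RV P >-> B}) : \bar R :=
  (\esum_(x in [set: B])
    - (distribution P X [set x] * lne (distribution P X [set x])))%E.

End information.

(* [counting] is +oo on infinite sets and [lne +oo = +oo]. *)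
Definition log_card {R : realType} (C : choiceType) : \bar R :=
  lne (counting [set: C]).

(* Main.v *)
(** Write [G c] for the entropy of any [c] of the coordinates, and let [Z] be
    [l] coordinates disjoint from the first [k], with [l <= n - k]. For [mu]
    take the law of the conditional law of one coordinate given [Z]. By joint
    convexity, the relative entropy is at most the conditional multi-information
    of the first [k] coordinates given [Z], which exchangeability turns into
    [k (G (l+1) - G l) - (G (k+l) - G l)]. As [h l = G (l+1) - G l] lies between
    [0] and [G 1], the sum of these bounds over [l = 0, ..., n - k] telescopes
    to at most [k (k-1) / 2 * G 1], so some [l] does at least as well as the
    average. All the entropy inequalities needed (convexity, subadditivity, the
    bound by [log |A|]) are instances of [ln x <= x - 1] applied to a likelihood
    ratio with mean at most [1]. *)

Require Import Defs.
From HB Require Import structures.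
From mathcomp Require Import all_boot all_order all_fingroup all_algebra.
From mathcomp Require Import all_classical all_reals all_analysis.
From mathcomp Require Import measurable_realfun ring lra.

Set Implicit Arguments.
Unset Strict Implicit.
Unset Printing Implicit Defensive.

Import Order.TTheory GRing.Theory Num.Theory.
Import numFieldNormedType.Exports.

Local Open Scope classical_set_scope.
Local Open Scope ring_scope.
Local Open Scope ereal_scope.

(** * Integration on countable discrete spaces *)

Lemma discrete_of_set1 d (B : measurableType d) :
  countable [set: B] -> (forall x : B, measurable [set x]) ->
  forall F : set B, measurable F.
Proof.
move=> cB mB F; apply: countable_measurable => //.
exact: sub_countable (subset_card_le (@subsetT _ F)) cB.
Qed.

Lemma integral_set1_cst d (B : measurableType d) (R : realType)
    (m : {measure set B -> \bar R}) (f : B -> \bar R) (b : B) :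
  measurable [set b] -> \int[m]_(x in [set b]) f x = f b * m [set b].
Proof.
move=> mb; rewrite -integral_cst//; apply: eq_integral => x.
by rewrite inE => ->.
Qed.

Section discrete_space.
Context d (B : measurableType d) (R : realType) (m : {measure set B -> \bar R}).
Hypotheses (cB : countable [set: B]) (mB : forall F : set B, measurable F).

Lemma measurable_discrete d' (C : measurableType d') (f : B -> C) D :
  measurable_fun D f.
Proof. by move=> _ Y _; exact: mB. Qed.

(** An injection [e] into the naturals splits the space into countably many fibres, each empty or a
    single point, and the integral is summed over them. *)
Lemma integral_discrete (f : B -> \bar R) : (forall x, 0 <= f x) ->
  \int[m]_x f x = \esum_(x in [set: B]) (f x * m [set x]).
Proof.
move=> f0; have /countable_injP[e einj] := cB.
pose F n := e @^-1` [set n].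
have FT : \bigcup_n F n = [set: B].
  by rewrite -subTset => x _; exists (e x).
have tF : trivIset setT F.
  by move=> i j _ _ [x []]; rewrite /F /= => <- <-.
rewrite -FT ge0_integral_bigcup//.
rewrite esum_bigcupT//; last by move=> x; exact: mule_ge0.
rewrite nneseries_esumT; last by move=> n; exact: integral_ge0.
apply: eq_esum => n _.
have [->|/set0P[b Fb]] := eqVneq (F n) set0.
  by rewrite integral_set0 esum_set0.
have -> : F n = [set b].
  apply/seteqP; split => [x Fx|x ->//]; apply: einj; rewrite ?inE//.
  by rewrite Fx Fb.
by rewrite integral_set1_cst// esum_set1// mule_ge0.
Qed.

(** The points of mass zero form a null set because their masses sum to zero. Pointwise estimates
    with logarithms thus need checking only at points of positive mass. *)
Lemma ae_atoms (P : B -> Prop) :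
  (forall x, m [set x] != 0 -> P x) -> {ae m, forall x, P x}.
Proof.
move=> H; exists [set x | m [set x] = 0]; split => //.
  rewrite -[X in m X]setIT -integral_indic// integral_discrete//.
    apply: esum1 => x _; rewrite indicE.
    have [|_] := boolP (x \in _); last by rewrite mul0e.
    by rewrite inE mul1e.
by move=> x /= nP; apply/eqP; apply: contra_notT nP => /H.
Qed.

Implicit Types f g l u : B -> R.

Lemma le_Rintegral_atoms f g :
  m.-integrable setT (EFin \o f) -> m.-integrable setT (EFin \o g) ->
  (forall x, m [set x] != 0 -> (f x <= g x)%R) ->
  (\int[m]_x f x <= \int[m]_x g x)%R.
Proof.
move=> fi gi fg; rewrite -subr_ge0 -RintegralB//.
(* Almost everywhere [g - f] is its own absolute value, which is nonnegative at every point. *)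
rewrite /Rintegral (ae_eq_integral (fun x => `|g x - f x|%:E)) //.
- by apply: fine_ge0; apply: integral_ge0 => x _; rewrite lee_fin.
- apply: ae_atoms => x mx _; rewrite ger0_norm// subr_ge0; exact: fg.
Qed.

(** Domination by [|l| + |u|]. Below, one of the two bounds typically comes from [ln x <= x - 1]. *)
Lemma integrable_sandwich l f u :
  m.-integrable setT (EFin \o l) -> m.-integrable setT (EFin \o u) ->
  (forall x, m [set x] != 0 -> (l x <= f x <= u x)%R) ->
  m.-integrable setT (EFin \o f).
Proof.
move=> li ui lfu; apply/integrableP; split; first exact: measurable_discrete.
have lui : m.-integrable setT ((abse \o (EFin \o l)) \+ (abse \o (EFin \o u))).
  by apply: integrableD => //; exact: integrable_abse.
have /integrableP[_] := lui; apply: le_lt_trans.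
apply: ae_ge0_le_integral => //; [exact: measurable_discrete..|].
apply: ae_atoms => x /lfu /andP[lf fu] _ /=.
rewrite lee_fin [leRHS]ger0_norm ?addr_ge0//.
have := ler_norm (u x); have := ler_norm (- l x)%R; rewrite normrN.
have := normr_ge0 (u x); have := normr_ge0 (l x).
by rewrite ler_norml; lra.
Qed.

End discrete_space.

Lemma discrete_prod d1 d2 (B1 : measurableType d1) (B2 : measurableType d2) :
  countable [set: B1] -> countable [set: B2] ->
  (forall F : set B1, measurable F) -> (forall F : set B2, measurable F) ->
  countable [set: B1 * B2] /\ (forall F : set (B1 * B2), measurable F).
Proof.
move=> c1 c2 m1 m2.
have c12 : countable [set: B1 * B2] by rewrite -setXTT; exact: countableX.
split=> //; apply: discrete_of_set1 => // -[x y].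
rewrite (_ : [set _] = [set x] `*` [set y]); first exact: measurableX.
by apply/seteqP; split => [[a b] [-> ->]|[a b] /= [-> ->]].
Qed.

Lemma discrete_tuple d (B : measurableType d) n :
  countable [set: B] -> (forall F : set B, measurable F) ->
  countable [set: n.-tuple B] /\ (forall F : set (n.-tuple B), measurable F).
Proof.
move=> cB mB; have cT : countable [set: n.-tuple B].
  have /countable_injP[e einj] := cB.
  apply/countable_injP; exists (fun t => pickle (map e t)) => s t _ _.
  move=> /(pcan_inj pickleK) st; apply: val_inj.
  by apply: inj_map st => x y; apply: einj; rewrite inE.
split=> //; apply: discrete_of_set1 => // x.
rewrite (_ : [set x] =
    \bigcap_(i in [set: 'I_n]) (@tnth n B ^~ i @^-1` [set tnth x i])).
  apply: fin_bigcap_measurable => // i _.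
  by rewrite -[X in measurable X]setTI; exact: measurable_tnth.
apply/seteqP; split => [y -> //|y xy]; apply: eq_from_tnth => i; exact: xy.
Qed.

Section discrete_measure.
Context d (B : measurableType d) (R : realType).
Hypotheses (cB : countable [set: B]) (mB : forall F : set B, measurable F).

Lemma null_of_atoms (m : {measure set B -> \bar R}) (F : set B) :
  (forall x, F x -> m [set x] = 0) -> m F = 0.
Proof.
move=> F0; rewrite -[F]setIT -integral_indic// integral_discrete//.
apply: esum1 => x _; rewrite indicE.
have [|_] := boolP (x \in _); last by rewrite mul0e.
by rewrite inE mul1e => /F0.
Qed.

Lemma atom_le_integral (m : {measure set B -> \bar R}) (f : B -> \bar R) x :
  (forall y, 0 <= f y) -> f x * m [set x] <= \int[m]_y f y.
Proof.
move=> f0; rewrite -integral_set1_cst//; apply: ge0_subset_integral => //.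
Qed.

Lemma relative_entropy_discrete (P Q : probability B R) :
  (forall x, Q [set x] = 0 -> P [set x] = 0) ->
  relative_entropy P Q =
  \int[P]_x (ln (fine (P [set x]) / fine (Q [set x])))%:E.
Proof.
move=> PQ; have dom : P `<< Q.
  move=> N /(measure0_null_setP _ (mB N)) QN.
  apply/measure0_null_setP => //; apply: null_of_atoms => x Nx; apply: PQ.
  by apply/eqP; rewrite -measure_le0 -QN le_measure// ?inE// => y ->.
rewrite /relative_entropy asboolT//.
apply: ae_eq_integral => //.
apply: ae_atoms => // x Px _.
have Qx : Q [set x] != 0 by apply: contra_neq Px; exact: PQ.
(* On an atom the derivative [r] satisfies [P {x} = r * Q {x}] with [Q {x}] nonzero, so it is the
   ratio of the masses. *)
have := @Radon_Nikodym_integral _ _ _ (charge_of_finite_measure P) Q [set x]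
  dom (mB _).
have := @Radon_Nikodym_fin_num _ _ _ (charge_of_finite_measure P) Q x dom.
rewrite integral_set1_cst//= /charge_of_finite_measure.
move: (Radon_Nikodym _ _ _) => r rf PE.
have Qf := fin_num_measure Q [set x] (mB _).
have Q0 : fine (Q [set x]) != 0%R by rewrite fine_eq0.
rewrite PE fineM// mulfK// -{1}(fineK rf) lne_EFin//.
have : 0 < r * Q [set x] by rewrite -PE lt0e Px measure_ge0.
rewrite -(fineK rf) -(fineK Qf) lte_fin pmulr_lgt0//.
by rewrite lt0r Q0 fine_ge0.
Qed.

End discrete_measure.

(** * Self-information and relative entropy to a mixture *)

Lemma ln_le_subr1 (R : realType) (x : R) : (0 < x)%R -> (ln x <= x - 1)%R.
Proof.
by move=> x0; rewrite -{1}(subrK 1%R x) [X in ln X]addrC le_ln1Dx//; lra.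
Qed.

Lemma Rintegral_cst1 d (B : measurableType d) (R : realType)
    (m : probability B R) (r : R) : (\int[m]_t r = r)%R.
Proof. by rewrite Rintegral_cst//= probability_setT mulr1. Qed.

Lemma esum_prod (R : realType) (T1 T2 : choiceType) (a : T1 * T2 -> \bar R) :
  (forall p, 0 <= a p) ->
  \esum_(p in [set: T1 * T2]) a p =
  \esum_(x in [set: T1]) \esum_(y in [set: T2]) a (x, y).
Proof.
move=> a0; rewrite esum_esum// (_ : [set: T1] `*`` _ = [set: T1 * T2]).
  by apply: eq_esum => -[].
by apply/seteqP; split.
Qed.

Section integrable_real.
Context d (B : measurableType d) (R : realType) (m : {measure set B -> \bar R}).
Implicit Types f g : B -> R.

Lemma integrable_addr f g :
  m.-integrable setT (EFin \o f) -> m.-integrable setT (EFin \o g) ->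
  m.-integrable setT (EFin \o (fun t => f t + g t)%R).
Proof. by move=> fi gi; have := integrableD measurableT fi gi. Qed.

Lemma integrable_subr f g :
  m.-integrable setT (EFin \o f) -> m.-integrable setT (EFin \o g) ->
  m.-integrable setT (EFin \o (fun t => f t - g t)%R).
Proof. by move=> fi gi; have := integrableB measurableT fi gi. Qed.

End integrable_real.

Section information.
Context d (B : measurableType d) (R : realType) (m : probability B R).
Hypotheses (cB : countable [set: B]) (mB : forall F : set B, measurable F).

Definition discrete_rv d' (C : measurableType d') (V : B -> C) :
    {mfun B >-> C} :=
  HB.pack V (isMeasurableFun.Build _ _ _ _ V
    (measurable_discrete mB (D := setT) V)).

Definition discrete_law d' (C : measurableType d') (V : B -> C) :
  probability C R := distribution m (discrete_rv V).

(** The likelihood is read at the sample point [t] rather than at the value [V t], so that [C] needs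
    no structure. *)
Definition pmass (C : Type) (V : B -> C) (t : B) : R :=
  fine (m [set s | V s = V t]).

(** Self-information; its mean under [m] is the Shannon entropy of [V]. *)
Definition info (C : Type) (V : B -> C) (t : B) : R := (- ln (pmass V t))%R.

Lemma pmassE (C : Type) (V : B -> C) t :
  (pmass V t)%:E = m [set s | V s = V t].
Proof. by rewrite fineK// fin_num_measure. Qed.

Lemma pmass_ge0 (C : Type) (V : B -> C) t : (0 <= pmass V t)%R.
Proof. exact: fine_ge0. Qed.

Lemma pmass_le1 (C : Type) (V : B -> C) t : (pmass V t <= 1)%R.
Proof. by rewrite -lee_fin pmassE probability_le1. Qed.

Lemma pmass_gt0 (C : Type) (V : B -> C) t :
  m [set t] != 0 -> (0 < pmass V t)%R.
Proof.
move=> mt; rewrite -lte_fin pmassE.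
have : 0 < m [set t] by rewrite lt0e mt measure_ge0.
by move=> /lt_le_trans -> //; rewrite le_measure ?inE// => s ->.
Qed.

Lemma eq_pmass (C C' : Type) (V : B -> C) (W : B -> C') t :
  (forall s, V s = V t <-> W s = W t) -> pmass V t = pmass W t.
Proof.
move=> VW; rewrite /pmass; congr (fine (m _)).
by apply/seteqP; split => s /= /VW.
Qed.

Lemma info_ge0 (C : Type) (V : B -> C) t : (0 <= info V t)%R.
Proof. by rewrite oppr_ge0 ln_le0// pmass_le1. Qed.

Lemma le_info (C C' : Type) (V : B -> C) (W : B -> C') t :
  m [set t] != 0 -> (forall s, W s = W t -> V s = V t) ->
  (info V t <= info W t)%R.
Proof.
move=> mt VW; rewrite lerN2 ler_ln ?posrE ?pmass_gt0//.
by rewrite -lee_fin !pmassE le_measure ?inE// => s /= /VW.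
Qed.

(** Summing over the values [c] of [V], the mass of [c] cancels the denominator. Values of mass zero
    contribute [0] instead of [f c], hence only an inequality. This bounds the mean of each
    likelihood ratio below. *)
Lemma integral_div_pmass d' (C : measurableType d') (V : B -> C) (f : C -> R) :
  countable [set: C] -> (forall F : set C, measurable F) ->
  (forall c, 0 <= f c)%R ->
  \int[m]_t (f (V t) / pmass V t)%:E <= \esum_(c in [set: C]) (f c)%:E.
Proof.
move=> cC mC f0.
pose h c := (f c / fine (discrete_law V [set c]))%:E.
have h0 c : 0 <= h c by rewrite lee_fin divr_ge0// fine_ge0.
rewrite (_ : \int[m]_t _ = \int[discrete_law V]_c h c); last first.
  by rewrite ge0_integral_distribution//; exact: measurable_discrete.
rewrite integral_discrete//; apply: le_esum => c _.
rewrite -[X in _ * X](fineK (fin_num_measure _ _ (mC _))) -EFinM lee_fin.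
have [->|p0] := eqVneq (fine (discrete_law V [set c])) 0%R.
  by rewrite mulr0.
by rewrite divfK.
Qed.

Lemma ge0_integrable (f : B -> R) :
  (forall t, 0 <= f t)%R -> \int[m]_t (f t)%:E < +oo ->
  m.-integrable setT (EFin \o f).
Proof.
move=> f0 fi; apply/integrableP; split; first exact: measurable_discrete.
by rewrite (eq_integral (EFin \o f))// => t _; rewrite gee0_abs ?lee_fin.
Qed.

Lemma Rintegral_le1 (f : B -> R) : (forall t, 0 <= f t)%R ->
  \int[m]_t (f t)%:E <= 1 -> (\int[m]_t f t <= 1)%R.
Proof.
move=> f0 fi; rewrite -lee_fin /Rintegral fineK//.
rewrite ge0_fin_numE ?(le_lt_trans fi) ?ltry//.
by apply: integral_ge0 => t _; rewrite lee_fin.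
Qed.

Section subadditivity.
Context d1 d2 (C : measurableType d1) (D : measurableType d2).
Hypotheses (cC : countable [set: C]) (mC : forall F : set C, measurable F)
           (cD : countable [set: D]) (mD : forall F : set D, measurable F).
Variables (V : B -> C) (W : B -> D).
Let U t := (V t, W t).

(** The likelihood ratio of the product of the marginal laws to the joint law. *)
Let rho t := (pmass V t * pmass W t / pmass U t)%R.

Let rho_ge0 t : (0 <= rho t)%R.
Proof. by rewrite divr_ge0 ?mulr_ge0 ?pmass_ge0. Qed.

Let rho_le1 : \int[m]_t (rho t)%:E <= 1.
Proof.
have [cCD mCD] := discrete_prod cC cD mC mD.
pose f (p : C * D) : R :=
  (fine (discrete_law V [set p.1]) * fine (discrete_law W [set p.2]))%R.
apply: (@le_trans _ _ (\esum_(p in [set: C * D]) (f p)%:E)).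
  apply: integral_div_pmass => // p.
  by rewrite mulr_ge0 ?fine_ge0.
rewrite esum_prod; last by move=> p; rewrite lee_fin mulr_ge0 ?fine_ge0.
rewrite -(probability_setT (discrete_law V)) -[X in _ <= _ X]setIT.
rewrite -integral_indic// integral_discrete//.
apply: le_esum => c _; rewrite indicT mul1e.
rewrite (_ : esum _ _ =
    \int[discrete_law W]_z (cst (discrete_law V [set c]) z)).
  by rewrite integral_cst// [X in _ * X]probability_setT mule1.
rewrite integral_discrete//; apply: eq_esum => z _.
by rewrite EFinM !fineK ?fin_num_measure.
Qed.

(** Subadditivity of entropy: [ln rho <= rho - 1] bounds [info U] by [info V + info W + rho - 1],
    and [rho] has mean at most [1]. Together with [info U >= 0] the same bound gives
    integrability. *)
Lemma info_pair :
  m.-integrable setT (EFin \o info V) -> m.-integrable setT (EFin \o info W) ->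
  m.-integrable setT (EFin \o info U) /\
  (\int[m]_t info U t <= \int[m]_t info V t + \int[m]_t info W t)%R.
Proof.
move=> iV iW.
have irho : m.-integrable setT (EFin \o rho).
  by apply: ge0_integrable => //; exact: le_lt_trans (rho_le1) (ltry _).
have ii : m.-integrable setT
    (EFin \o (fun t => info V t + info W t + rho t - 1)%R).
  apply: integrable_subr => //; last exact: finite_measure_integrable_cst.
  by apply: integrable_addr => //; exact: integrable_addr.
have le t : m [set t] != 0 ->
    (info U t <= info V t + info W t + rho t - 1)%R.
  move=> mt.
  have [V0 W0 U0] : [/\ 0 < pmass V t, 0 < pmass W t & 0 < pmass U t]%R.
    by rewrite !pmass_gt0.
  have : (ln (rho t) <= rho t - 1)%R.
    by apply: ln_le_subr1; rewrite divr_gt0 ?mulr_gt0.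
  rewrite {1}/rho ln_div ?posrE ?mulr_gt0// lnM ?posrE// /info.
  lra.
have iU : m.-integrable setT (EFin \o info U).
  apply: (@integrable_sandwich _ _ _ m cB mB (cst 0%R) _ _ _ ii).
    exact: finite_measure_integrable_cst.
  by move=> t mt; rewrite info_ge0 le.
split=> //; apply: le_trans (le_Rintegral_atoms cB mB iU ii le) _.
rewrite RintegralB//; last 2 first.
- by apply: integrable_addr => //; exact: integrable_addr.
- exact: finite_measure_integrable_cst.
rewrite RintegralD//; last exact: integrable_addr.
rewrite RintegralD// Rintegral_cst1.
by have := Rintegral_le1 rho_ge0 rho_le1; lra.
Qed.

End subadditivity.
End information.

Section relative_entropy_mixture.
Context d (B : measurableType d) (R : realType) (m : probability B R).
Context d1 d2 (C : measurableType d1) (D : measurableType d2).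
Hypotheses (cB : countable [set: B]) (mB : forall F : set B, measurable F)
           (cC : countable [set: C]) (mC : forall F : set C, measurable F)
           (cD : countable [set: D]) (mD : forall F : set D, measurable F).
Variables (V : B -> C) (Z : B -> D) (W : D -> probability C R)
          (P M : probability C R).
Hypotheses (PE : forall F, P F = m (V @^-1` F))
           (ME : forall c, M [set c] = \int[m]_t W (Z t) [set c]).
Let U t := (V t, Z t).
Let w t := fine (W (Z t) [set V t]).
Hypothesis w_gt0 : forall t, m [set t] != 0 -> (0 < w t)%R.
Let p c := fine (P [set c]).
Let q c := fine (M [set c]).

Let pV t : p (V t) = pmass m V t.
Proof. by rewrite /p PE. Qed.

Let qE c : (q c)%:E = M [set c].
Proof. by rewrite fineK// fin_num_measure. Qed.

(** The single atom [t] already contributes [W (Z t) {V t} * m {t}] to the mixture. *)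
Let q_gt0 t : m [set t] != 0 -> (0 < q (V t))%R.
Proof.
move=> mt; rewrite -lte_fin qE ME.
apply: (@lt_le_trans _ _ (W (Z t) [set V t] * m [set t])).
  rewrite mule_gt0 ?lt0e ?mt ?measure_ge0// andbT.
  by rewrite -fine_eq0 ?fin_num_measure// gt_eqF// w_gt0.
exact: (@atom_le_integral _ _ _ mB m (fun s => W (Z s) [set V t])).
Qed.

Let dominates c : M [set c] = 0 -> P [set c] = 0.
Proof.
move=> Mc; rewrite PE; apply: (null_of_atoms cB mB) => t Vt.
apply/eqP/negPn/negP => /q_gt0.
by rewrite /q Vt Mc ltxx.
Qed.

(** If [Z] keeps its law and [V] is drawn from [W] given [Z], then [V] has law [q]. The factor
    [p / q] restores the law of [V]; [rho] compares these weights with the joint law of [V] and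
    [Z]. *)
Let rho t := (p (V t) / q (V t) * (pmass m Z t * w t) / pmass m U t)%R.

Let rho_ge0 t : (0 <= rho t)%R.
Proof. by rewrite !mulr_ge0 ?invr_ge0 ?fine_ge0. Qed.

Let rho_le1 : \int[m]_t (rho t)%:E <= 1.
Proof.
have [cCD mCD] := discrete_prod cC cD mC mD.
pose f (x : C * D) : R := (p x.1 / q x.1 *
  (fine (discrete_law m mB Z [set x.2]) * fine (W x.2 [set x.1])))%R.
have f0 x : (0 <= f x)%R by rewrite !mulr_ge0 ?invr_ge0 ?fine_ge0.
apply: (@le_trans _ _ (\esum_(x in [set: C * D]) (f x)%:E)).
  exact: (integral_div_pmass m mB U cCD mCD).
rewrite esum_prod; last by move=> x; rewrite lee_fin.
rewrite -(probability_setT P) -[X in _ <= _ X]setIT.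
rewrite -integral_indic// integral_discrete//.
apply: le_esum => c _; rewrite indicT mul1e.
(* Summing over [z] first turns the remaining weights into [q c], which cancels against
   [p c / q c]. *)
rewrite (_ : esum _ _ = (p c / q c)%:E *
    \int[discrete_law m mB Z]_z W z [set c]); last first.
  rewrite -ge0_integralZl//; last by rewrite lee_fin divr_ge0// fine_ge0.
  rewrite integral_discrete//; last first.
    by move=> z; rewrite mule_ge0// lee_fin divr_ge0// fine_ge0.
  apply: eq_esum => z _; rewrite /f /= !EFinM !fineK ?fin_num_measure//.
  by rewrite -[RHS]muleA [_ * W z _]muleC.
rewrite ge0_integral_distribution//.
rewrite [X in _ * X](_ : _ = (q c)%:E); last by rewrite qE ME.
rewrite [leRHS](_ : _ = (p c)%:E); last by rewrite /p fineK// fin_num_measure.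
rewrite -EFinM lee_fin.
have [->|q0] := eqVneq (q c) 0%R; first by rewrite mulr0 fine_ge0.
by rewrite divfK.
Qed.

Hypotheses (iV : m.-integrable setT (EFin \o info m V))
           (iZ : m.-integrable setT (EFin \o info m Z))
           (iU : m.-integrable setT (EFin \o info m U))
           (iw : m.-integrable setT (EFin \o (fun t => ln (w t)))).

(** The right side is the mean relative entropy, given [Z], of the conditional law of [V] to [W], so
    this is joint convexity. It comes from integrating [ln rho <= rho - 1]. *)
Lemma relative_entropy_mixture_le : relative_entropy P M <=
  (\int[m]_t info m Z t - \int[m]_t info m U t - \int[m]_t ln (w t))%R%:E.
Proof.
pose phi c := ln (p c / q c).
have irho : m.-integrable setT (EFin \o rho).
  by apply: (ge0_integrable mB) => //; exact: le_lt_trans rho_le1 (ltry _).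
pose u t := (info m Z t - info m U t - ln (w t) + rho t - 1)%R.
have i1 : m.-integrable setT
    (EFin \o (fun t => info m Z t - info m U t - ln (w t))%R).
  by apply: integrable_subr => //; exact: integrable_subr.
have i2 : m.-integrable setT
    (EFin \o (fun t => info m Z t - info m U t - ln (w t) + rho t)%R).
  exact: integrable_addr.
have iu : m.-integrable setT (EFin \o u).
  by apply: integrable_subr => //; exact: finite_measure_integrable_cst.
have lphi t : m [set t] != 0 -> (- info m V t <= phi (V t) <= u t)%R.
  move=> mt; have q0 := q_gt0 mt; have w0 := w_gt0 mt.
  have [V0 Z0 U0] : [/\ 0 < pmass m V t, 0 < pmass m Z t & 0 < pmass m U t]%R.
    by rewrite !pmass_gt0.
  rewrite /phi ln_div ?posrE ?pV//.
  apply/andP; split.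
    (* As [q <= 1], the ratio is at least [p]; this lower bound serves for the integrability of
       [phi] along [V]. *)
    have : (ln (q (V t)) <= 0)%R.
      by rewrite ln_le0// -lee_fin qE probability_le1.
    by rewrite /info; lra.
  have : (ln (rho t) <= rho t - 1)%R.
    by apply: ln_le_subr1; rewrite !(mulr_gt0, invr_gt0)// pV.
  rewrite {1}/rho pV !(lnM, lnV) ?posrE ?(mulr_gt0, invr_gt0)// /u /info.
  lra.
have iphi : m.-integrable setT (EFin \o (phi \o V)).
  apply: (integrable_sandwich cB mB _ iu lphi).
  by have := integrableN iV.
rewrite relative_entropy_discrete//.
rewrite (eq_measure_integral (discrete_law m mB V)) => [|F _ _]; last first.
  exact: PE.
rewrite integral_distribution//.
rewrite -[X in X <= _]fineK; last exact: integrable_fin_num.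
rewrite lee_fin.
apply: le_trans (le_Rintegral_atoms cB mB iphi iu _) _.
  by move=> t /lphi /andP[].
rewrite RintegralB//; last exact: finite_measure_integrable_cst.
rewrite RintegralD// RintegralB//; last exact: integrable_subr.
rewrite RintegralB// Rintegral_cst1.
by have := Rintegral_le1 rho_ge0 rho_le1; lra.
Qed.

End relative_entropy_mixture.

(** * Block entropies of exchangeable tuples *)

Section exchangeable_law.
Context d (A : measurableType d) (R : realType) (n : nat).
Hypotheses (cA : countable [set: A]) (mA : forall F : set A, measurable F).

(** Masking the coordinates outside [J] by [point] keeps all blocks in one type; the masked tuple
    and the block determine each other. *)
Definition restr (J : {set 'I_n}) (t : n.-tuple A) : n.-tuple A :=
  [tuple if i \in J then tnth t i else point | i < n].

Definition permute (s : 'S_n) (t : n.-tuple A) : n.-tuple A :=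
  [tuple tnth t (s i) | i < n].

Lemma restrP (J : {set 'I_n}) (s t : n.-tuple A) :
  restr J s = restr J t <-> {in J, forall i, tnth s i = tnth t i}.
Proof.
split=> [st i iJ|st].
  by have := congr1 (@tnth _ _ ^~ i) st; rewrite !tnth_mktuple iJ.
by apply: eq_from_tnth => i; rewrite !tnth_mktuple; case: ifP => // /st.
Qed.

Lemma perm_imset_card (J K : {set 'I_n}) : #|J| = #|K| ->
  exists s : 'S_n, s @: J = K.
Proof.
move=> JK.
pose e (L : {set 'I_n}) := enum L ++ enum (~: L).
have eL L : perm_eq (e L) (enum 'I_n).
  apply: uniq_perm; rewrite ?enum_uniq//.
    rewrite cat_uniq !enum_uniq /= andbT -all_predC.
    by apply/allP => i /=; rewrite !mem_enum inE.
  by move=> i; rewrite mem_cat !mem_enum inE orbN.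
have se L : size (e L) = n by rewrite (perm_size (eL L)) size_enum_ord.
have ue L : uniq (e L) by rewrite (perm_uniq (eL L)) enum_uniq.
have me L i : i \in e L by rewrite (perm_mem (eL L)) mem_enum.
have ie i : (index i (e J) < size (e K))%N.
  by have := me J i; rewrite -index_mem !se.
(* [e] lists a set before its complement; [f] matches equal positions in the lists for [J] and
   [K]. *)
pose f i := nth i (e K) (index i (e J)).
have finj : injective f.
  move=> i j; rewrite /f (set_nth_default i j)// => /eqP.
  rewrite nth_uniq// => /eqP ij.
  by rewrite -(nth_index i (me J i)) -(nth_index i (me J j)) ij.
exists (perm finj); apply/eqP.
rewrite eqEcard card_imset ?JK ?leqnn ?andbT; last exact: perm_inj.
apply/fintype.subsetP => _ /imsetP[i iJ ->]; rewrite permE /f /e.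
have iJ' : (index i (enum J) < #|J|)%N by rewrite cardE index_mem mem_enum.
rewrite index_cat mem_enum iJ nth_cat -cardE -JK iJ'.
by rewrite -mem_enum mem_nth// -cardE -JK.
Qed.

Variable m : probability (n.-tuple A) R.
Hypothesis m_permute : forall s F, m (permute s @^-1` F) = m F.

Let cT : countable [set: n.-tuple A] := (discrete_tuple n cA mA).1.
Let mT : forall F : set (n.-tuple A), measurable F :=
  (discrete_tuple n cA mA).2.

Lemma pmass_restr_imset (s : 'S_n) (J : {set 'I_n}) t :
  pmass m (restr (s @: J)) t = pmass m (restr J) (permute s t).
Proof.
rewrite /pmass -[in RHS](m_permute s); congr (fine (m _)).
apply/seteqP; split => u /=.
  move=> /restrP tu; apply/restrP => i iJ; rewrite !tnth_mktuple.
  by apply: tu; exact: imset_f.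
move=> /restrP tu; apply/restrP => _ /imsetP[i iJ ->].
by have := tu i iJ; rewrite !tnth_mktuple.
Qed.

(** Some permutation carries [J] to [K], and [m] is invariant under it. The integral is
    extended-real so that the identity applies before the entropies are known to be finite. *)
Lemma integral_info_restr_card (J K : {set 'I_n}) : #|J| = #|K| ->
  \int[m]_t (info m (restr J) t)%:E = \int[m]_t (info m (restr K) t)%:E.
Proof.
move=> /perm_imset_card[s <-].
rewrite (eq_measure_integral (discrete_law m mT (permute s))) => [|F _ _];
  last by rewrite -[LHS](m_permute s).
rewrite ge0_integral_distribution//; last first.
  by move=> t; rewrite lee_fin info_ge0.
by apply: eq_integral => t _ /=; rewrite /info pmass_restr_imset.
Qed.

Definition block_entropy (J : {set 'I_n}) : R :=
  (\int[m]_t info m (restr J) t)%R.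

Lemma block_entropy_card (J K : {set 'I_n}) :
  #|J| = #|K| -> block_entropy J = block_entropy K.
Proof.
by move=> JK; rewrite /block_entropy /Rintegral (integral_info_restr_card JK).
Qed.

Hypothesis finite_entropy : forall i,
  m.-integrable setT (EFin \o info m (restr [set i])).

Lemma info_restr0 t : info m (restr finset.set0) t = 0%R.
Proof.
rewrite /info /pmass (_ : [set _ | _] = setT) ?probability_setT ?ln1 ?oppr0//.
by rewrite -subTset => s _; apply/restrP => i; rewrite inE.
Qed.

Lemma info_restrU1 i J t :
  info m (restr (i |: J)) t = info m (fun s => (restr J s, restr [set i] s)) t.
Proof.
rewrite /info; congr (- ln _)%R; apply: eq_pmass => s; split.
  move=> /restrP st; congr (_, _); apply/restrP => j.
    by move=> jJ; apply: st; rewrite !inE jJ orbT.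
  by rewrite inE => /eqP ->; apply: st; rewrite !inE eqxx.
move=> st; have /restrP sJ := congr1 fst st; have /restrP si := congr1 snd st.
apply/restrP => j /setU1P[->|/sJ//].
by apply: si; rewrite inE.
Qed.

(** Induction on the size of [J]: after removing one coordinate, [info_pair] transfers integrability
    from the smaller block and the single coordinate. *)
Lemma integrable_info_restr J : m.-integrable setT (EFin \o info m (restr J)).
Proof.
have [c] := ubnP #|J|; elim: c J => // c IH J; rewrite ltnS => Jc.
have [->|[i iJ]] := set_0Vmem J.
  rewrite (_ : info m (restr finset.set0) = cst 0%R); last first.
    by apply/funext => t; rewrite info_restr0.
  exact: finite_measure_integrable_cst.
have {}/IH iJ' : (#|J :\ i| < c)%N by move: Jc; rewrite (cardsD1 i) iJ.
rewrite -(finset.setD1K iJ).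
rewrite (_ : info m _ = info m (fun s => (restr (J :\ i) s, restr [set i] s))).
  by have [] := info_pair cT mT cT mT cT mT iJ' (finite_entropy i).
by apply/funext => t; rewrite info_restrU1.
Qed.

Lemma block_entropy0 : block_entropy finset.set0 = 0%R.
Proof.
rewrite /block_entropy (@eq_Rintegral _ _ _ m setT (cst 0%R)).
  by rewrite Rintegral_cst1.
by move=> t _; rewrite info_restr0.
Qed.

Lemma block_entropy_ge0 J : (0 <= block_entropy J)%R.
Proof. by apply: Rintegral_ge0 => t _; exact: info_ge0. Qed.

Lemma block_entropyU1 i J :
  (block_entropy (i |: J) <= block_entropy J + block_entropy [set i])%R.
Proof.
rewrite /block_entropy.
rewrite (@eq_Rintegral _ _ _ m setT
    (info m (fun s => (restr J s, restr [set i] s)))); last first.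
  by move=> t _; rewrite info_restrU1.
have iJ := integrable_info_restr J.
by have [_] := info_pair cT mT cT mT cT mT iJ (finite_entropy i).
Qed.

Lemma le_block_entropy (J K : {set 'I_n}) :
  J \subset K -> (block_entropy J <= block_entropy K)%R.
Proof.
move=> /fintype.subsetP JK; apply: (le_Rintegral_atoms cT mT) => [||t mt].
- exact: integrable_info_restr.
- exact: integrable_info_restr.
- by apply: le_info => // s /restrP sK; apply/restrP => i /JK; exact: sK.
Qed.

End exchangeable_law.

(** * Averaging over the length of the conditioning block *)

Section averaging.
Local Open Scope ring_scope.
Variable R : realType.

(** Raising the shift from [i] to [i + 1] adds a telescoping sum equal to [h i - h (N + i)], which
    is at most [c]. *)
Lemma sum_shift_le (h : nat -> R) (c : R) N i :
  (forall j, 0 <= h j <= c) ->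
  \sum_(m < N) (h m - h (m + i)%N) <= i%:R * c.
Proof.
move=> hc; elim: i => [|i IH].
  by rewrite mul0r big1// => m _; rewrite addn0 subrr.
rewrite (eq_bigr (fun m : 'I_N =>
    (h m - h (m + i)%N) + (h (m + i)%N - h (m.+1 + i)%N))); last first.
  by move=> m _; rewrite addSnnS; lra.
rewrite big_split/= -natr1 mulrDl mul1r lerD//.
rewrite -(big_mkord xpredT (fun m => h (m + i)%N - h (m.+1 + i)%N)).
rewrite (telescope_sumr_eq (fun m => - h (m + i)%N))//; last first.
  by move=> m _; lra.
by have /andP[_ h1] := hc i; have /andP[h2 _] := hc (N + i)%N; lra.
Qed.

Lemma exists_le_mean (f : nat -> R) N :
  exists2 m, (m <= N)%N & f m * N.+1%:R <= \sum_(i < N.+1) f i.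
Proof.
apply: contrapT => H; pose S := \sum_(i < N.+1) f i.
suff : \sum_(i < N.+1) S < \sum_(i < N.+1) f i * N.+1%:R.
  by rewrite sumr_const card_ord -[ltLHS]mulr_natr -mulr_suml ltxx.
apply: ltr_sum => [|i _].
  by apply/hasP; exists ord0; rewrite ?mem_index_enum.
by rewrite ltNge; apply/negP => fS; apply: H; exists i; first by rewrite -ltnS.
Qed.

(** The left side is the sum over [i < k] of [h m - h (m + i)]. Summed over [m <= N] as well, it is
    at most the sum of [i * G 1] over [i < k], by [sum_shift_le]; some [m] does no worse than the
    average. *)
Lemma exists_block_le (G : nat -> R) k N :
  G 0%N = 0 -> (forall c, G c <= G c.+1) -> (forall c, G c.+1 <= G c + G 1%N) ->
  exists2 m, (m <= N)%N &
    k%:R * G m.+1 - (k%:R - 1) * G m - G (k + m)%N <=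
      k%:R * (k%:R - 1) / (2 * N.+1%:R) * G 1%N.
Proof.
move=> G0 Gle Gsub; pose h j := G j.+1 - G j.
have hc j : 0 <= h j <= G 1%N by have := Gle j; have := Gsub j; rewrite /h; lra.
have Gh m : \sum_(i < k) (h m - h (m + i)%N) =
    k%:R * G m.+1 - (k%:R - 1) * G m - G (k + m)%N.
  rewrite sumrB sumr_const card_ord -(big_mkord xpredT (fun i => h (m + i)%N)).
  rewrite (telescope_sumr_eq (fun i => G (m + i)%N))//; last first.
    by move=> i _; rewrite /h addnS.
  by rewrite addn0 (addnC k) /h -mulr_natl; lra.
have [m mN] := exists_le_mean (fun m => \sum_(i < k) (h m - h (m + i)%N)) N.
rewrite Gh => Hm; exists m => //.
have gauss : \sum_(i < k) i%:R = k%:R * (k%:R - 1) / 2 :> R.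
  elim: (k) => [|j IH]; first by rewrite big_ord0 !mul0r.
  by rewrite big_ord_recr /= IH -natr1; field.
have : \sum_(m < N.+1) \sum_(i < k) (h m - h (m + i)%N) <=
    k%:R * (k%:R - 1) / 2 * G 1%N.
  rewrite exchange_big /= -gauss mulr_suml; apply: ler_sum => i _.
  exact: sum_shift_le.
move=> /(le_trans Hm); rewrite -ler_pdivlMr ?ltr0n//; move/le_trans; apply.
rewrite le_eqVlt; apply/orP; left; apply/eqP.
by rewrite invfM; ring.
Qed.

End averaging.

(** * The mixing law *)

Lemma ln_prod (R : realType) (I : Type) (r : seq I) (f : I -> R) :
  (forall i, 0 < f i)%R ->
  (ln (\prod_(i <- r) f i) = \sum_(i <- r) ln (f i))%R.
Proof.
move=> f0; have : (0 < \prod_(i <- r) f i)%R by exact: prodr_gt0.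
elim: r => [|i r IH]; first by rewrite !big_nil ln1.
rewrite !big_cons => _; rewrite lnM ?posrE ?prodr_gt0// IH// prodr_gt0//.
Qed.

Lemma Rintegral_sum d (B : measurableType d) (R : realType)
    (m : probability B R) (I : Type) (r : seq I) (f : I -> B -> R) :
  (forall i, m.-integrable setT (EFin \o f i)) ->
  m.-integrable setT (EFin \o (fun t => \sum_(i <- r) f i t)%R) /\
  (\int[m]_t (\sum_(i <- r) f i t) = \sum_(i <- r) \int[m]_t f i t)%R.
Proof.
move=> fi; elim: r => [|i r [IH1 IH2]].
  under eq_fun do rewrite big_nil.
  rewrite big_nil Rintegral_cst1; split=> //.
  exact: finite_measure_integrable_cst.
under eq_fun do rewrite big_cons.
rewrite big_cons RintegralD// IH2; split=> //.
exact: integrable_addr.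
Qed.

Lemma mnormalize_mrestrE d (B : measurableType d) (R : realType)
    (m : probability B R) (D F : set B) (mD : measurable D) : m D != 0 ->
  mnormalize (mrestr m mD) m F = m (F `&` D) * (fine (m D))^-1%:E.
Proof.
move=> D0; rewrite /mnormalize /= /mrestr setTI (negbTE D0)/=.
by rewrite lt_eqF// ltey_eq fin_num_measure.
Qed.

Section conditional_mixture.
Context d (A : measurableType d) (R : realType) (n : nat).
Hypotheses (cA : countable [set: A]) (mA : forall F : set A, measurable F).
Variable m : probability (n.-tuple A) R.
Hypothesis m_permute : forall s F, m (permute s @^-1` F) = m F.
Hypothesis finite_entropy : forall i,
  m.-integrable setT (EFin \o info m (restr [set i])).
Variables (k : nat) (le_kn : (k <= n)%N) (i0 : 'I_n) (Z : {set 'I_n}).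

Let cT : countable [set: n.-tuple A] := (discrete_tuple n cA mA).1.
Let mT : forall F : set (n.-tuple A), measurable F :=
  (discrete_tuple n cA mA).2.
Let cTk : countable [set: k.-tuple A] := (discrete_tuple k cA mA).1.
Let mTk : forall F : set (k.-tuple A), measurable F :=
  (discrete_tuple k cA mA).2.

Definition head_tuple (t : n.-tuple A) : k.-tuple A :=
  [tuple tnth t (widen_ord le_kn i) | i < k].

Hypotheses (i0Z : i0 \notin Z) (wZ : forall i, widen_ord le_kn i \notin Z).

(* The conditional law of the coordinate [i0] given that the coordinates in [Z]
   are those of [z]; the default [m] of [mnormalize] is irrelevant, as it is
   only used on a null set. *)
Definition cond_coord (z : n.-tuple A) : probability A R :=
  discrete_law (mnormalize (mrestr m (mT [set t | restr Z t = z])) m) mT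
    (fun t => tnth t i0).

Lemma cond_coordE t (i : 'I_k) : m [set t] != 0 ->
  fine (cond_coord (restr Z t) [set tnth (head_tuple t) i]) =
  (pmass m (restr (widen_ord le_kn i |: Z)) t / pmass m (restr Z) t)%R.
Proof.
move=> mt; set j := widen_ord le_kn i.
have Z0 := pmass_gt0 mT (restr Z) mt.
rewrite [cond_coord _ _](_ : _ =
    m ((fun t => tnth t i0) @^-1` [set tnth (head_tuple t) i] `&`
      [set s | restr Z s = restr Z t]) *
    (fine (m [set s | restr Z s = restr Z t]))^-1%:E); last first.
  by apply: mnormalize_mrestrE; rewrite -(pmassE m mT) eqe gt_eqF.
rewrite -(pmassE m mT) fineM ?fin_num_measure//=.
congr (_ / _)%R; rewrite /pmass; congr fine.
(* The transposition of [i0] and [j] fixes every coordinate in [Z], so by exchangeability [i0] may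
   be replaced by [j]. *)
rewrite -(m_permute (tperm i0 j)); congr (m _).
have sZ (u : n.-tuple A) : restr Z (permute (tperm i0 j) u) = restr Z u.
  apply/restrP => l lZ; rewrite tnth_mktuple tpermD//.
    by apply: contraNneq i0Z => ->.
  by apply: contraNneq (wZ i) => wl; rewrite -/j wl.
apply/seteqP; split => u /=.
  rewrite sZ !tnth_mktuple tpermL => -[uj /restrP uZ].
  by apply/restrP => l /setU1P[->//|/uZ].
move=> /restrP ujZ; rewrite sZ !tnth_mktuple tpermL; split.
  by apply: ujZ; rewrite !inE eqxx.
by apply/restrP => l lZ; apply: ujZ; rewrite !inE lZ orbT.
Qed.

(** The likelihood of the first [k] coordinates if, given [Z], they were independent with law
    [cond_coord]. *)
Let w t := fine (product_power (cond_coord (restr Z t)) k [set head_tuple t]).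

Lemma product_power_cond_coord t : m [set t] != 0 -> w t =
  (\prod_(i < k) (pmass m (restr (widen_ord le_kn i |: Z)) t /
                  pmass m (restr Z) t))%R.
Proof.
move=> mt; rewrite /w.
rewrite (_ : [set head_tuple t] =
    [set s | forall i, [set tnth (head_tuple t) i] (tnth s i)]); last first.
  by apply/seteqP; split => [s ->//|s st]; apply: eq_from_tnth => i; exact: st.
rewrite (@product_power_box _ _ _ _ _ (fun i => [set tnth (head_tuple t) i]))//.
rewrite -[RHS]/(fine _%:E) -prodEFin; congr fine.
by apply: eq_bigr => i _; rewrite -cond_coordE// fineK// fin_num_measure.
Qed.

Let iR := integrable_info_restr cA mA finite_entropy.

(** The value of [ln (w t)] at atoms of positive mass, written with self-informations, whose
    integrability is known. *)
Let lnw t := (\sum_(i < k)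
  (info m (restr Z) t - info m (restr (widen_ord le_kn i |: Z)) t))%R.

Let w_gt0 t : m [set t] != 0 -> (0 < w t)%R.
Proof.
move=> mt; rewrite product_power_cond_coord//; apply: prodr_gt0 => i _.
by rewrite divr_gt0// pmass_gt0.
Qed.

Let wE t : m [set t] != 0 -> ln (w t) = lnw t.
Proof.
move=> mt; rewrite product_power_cond_coord// ln_prod; last first.
  by move=> i; rewrite divr_gt0// pmass_gt0.
apply: eq_bigr => i _.
rewrite ln_div ?posrE ?pmass_gt0// /info; lra.
Qed.

Let ilnw :
  m.-integrable setT (EFin \o lnw) /\ (\int[m]_t lnw t = \sum_(i < k)
    (block_entropy m Z - block_entropy m (widen_ord le_kn i |: Z)))%R.
Proof.
have idiff (i : 'I_k) : m.-integrable setT (EFin \o (fun t =>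
    info m (restr Z) t - info m (restr (widen_ord le_kn i |: Z)) t)%R).
  by apply: integrable_subr; exact: iR.
have [i1 i2] := Rintegral_sum (index_enum 'I_k) idiff.
split; first exact: i1.
rewrite [LHS]i2; apply: eq_bigr => i _.
by rewrite RintegralB//; exact: iR.
Qed.

Let iw : m.-integrable setT (EFin \o (fun t => ln (w t))).
Proof.
have [i1 _] := ilnw.
by apply: (integrable_sandwich cT mT i1 i1) => t mt; rewrite wE// lexx.
Qed.

Let Rintegral_w : (\int[m]_t ln (w t) = \sum_(i < k)
    (block_entropy m Z - block_entropy m (widen_ord le_kn i |: Z)))%R.
Proof.
have [i1 <-] := ilnw; apply/eqP; rewrite eq_le.
by apply/andP; split; apply: (le_Rintegral_atoms cT mT) => // t /wE ->.
Qed.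

(** The measure-valued map is measurable because every set of [n]-tuples is. *)
Definition mixing_law : probability (pprobability A R) R :=
  discrete_law m mT
    (fun t => cond_coord (restr Z t) : pprobability A R).

(** This is [relative_entropy_mixture_le] with [V] the first [k] coordinates and [W] the product
    powers of [cond_coord]; the mean of [ln w] becomes a sum of differences of block entropies. *)
Lemma relative_entropy_mixing_law (P : probability (k.-tuple A) R) :
  (forall F, P F = m (head_tuple @^-1` F)) ->
  relative_entropy P (mixture k mixing_law) <=
  (block_entropy m Z
   - block_entropy m ([set widen_ord le_kn i | i in 'I_k] :|: Z)%SET
   - \sum_(i < k)
       (block_entropy m Z - block_entropy m (widen_ord le_kn i |: Z)))%R%:E.
Proof.
move=> PE.
pose K : {set 'I_n} := [set widen_ord le_kn i | i in 'I_k]%SET.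
(* The first [k] coordinates and the block [K] determine each other, so their self-informations
   agree; likewise jointly with [Z]. *)
have eK t : info m head_tuple t = info m (restr K) t.
  rewrite /info; congr (- ln _)%R; apply: eq_pmass => s.
  split => [st|/restrP st].
    apply/restrP => _ /imsetP[i _ ->].
    by have := congr1 (@tnth _ _ ^~ i) st; rewrite !tnth_mktuple.
  by apply: eq_from_tnth => i; rewrite !tnth_mktuple; apply: st; exact: imset_f.
have eKZ t : info m (fun s => (head_tuple s, restr Z s)) t =
    info m (restr (K :|: Z)) t.
  rewrite /info; congr (- ln _)%R; apply: eq_pmass => s; split.
    move=> st; have /restrP sZ := congr1 snd st; have sK := congr1 fst st.
    apply/restrP => l /setUP[/imsetP[i _ ->]|/sZ//].
    by have := congr1 (@tnth _ _ ^~ i) sK; rewrite !tnth_mktuple.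
  move=> /restrP st; congr (_, _).
    apply: eq_from_tnth => i; rewrite !tnth_mktuple; apply: st.
    by rewrite inE imset_f.
  by apply/restrP => l lZ; apply: st; rewrite inE lZ orbT.
rewrite -Rintegral_w.
rewrite /block_entropy.
have <- : (\int[m]_t info m (fun s => (head_tuple s, restr Z s)) t =
    \int[m]_t info m (restr (K :|: Z)) t)%R.
  by apply: eq_Rintegral => t _; exact: eKZ.
apply: (relative_entropy_mixture_le cT mT cTk mTk cT mT
  (W := fun z => product_power (cond_coord z) k)) => //.
- move=> c; rewrite /= /mixture /mixing_law /discrete_law.
  rewrite ge0_integral_distribution//.
  exact: measurable_product_power.
- by rewrite (funext eK); exact: iR.
- by rewrite (funext eKZ); exact: iR.
Qed.

End conditional_mixture.

(** * Entropy of a single variable *)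

Section entropy_bounds.
Context d (A : measurableType d) (R : realType).
Hypotheses (cA : countable [set: A]) (mA : forall F : set A, measurable F).

Lemma entropy_integral d' (T : measurableType d') (P : probability T R)
    (Y : {RV P >-> A}) :
  entropy Y = \int[distribution P Y]_x (info (distribution P Y) id x)%:E.
Proof.
rewrite integral_discrete//; last by move=> x; rewrite lee_fin info_ge0.
apply: eq_esum => x _; rewrite /info /pmass.
rewrite (_ : [set s | id s = id x] = [set x])//.
have mY : measurable (Y @^-1` [set x]).
  by rewrite -[X in measurable X]setTI; exact: measurable_funPT.
have := fin_num_measure P _ mY; have := measure_ge0 P (Y @^-1` [set x]).
set S := Y @^-1` _.
(* Both sides depend only on the number [P S], which is replaced by a real [p]; at [p = 0] both
   vanish. *)
change (0 <= P S -> P S \is a fin_num ->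
  - (P S * lne (P S)) = (- ln (fine (P S)))%:E * P S).
case: (P S) => [p| |]//; rewrite lee_fin => p_ge0 _.
have [->|p0] := eqVneq p 0%R; first by rewrite mul0e mule0 oppe0.
by rewrite lne_EFin ?lt0r ?p0// -!EFinM -EFinN mulNr mulrC.
Qed.

Lemma esum_cst_finite (c : R) : finite_set [set: A] -> (0 <= c)%R ->
  \esum_(x in [set: A]) c%:E =
  (c * (size (finmap.enum_fset (fset_set [set: A])))%:R)%:E.
Proof.
move=> fA c0; rewrite esum_fset//.
rewrite fsbig_finite//= sumEFin big_const_seq count_predT iter_addr_0.
by rewrite mulr_natr.
Qed.

Lemma entropy_le_log_card d' (T : measurableType d') (P : probability T R)
    (Y : {RV P >-> A}) : entropy Y <= log_card A.
Proof.
rewrite entropy_integral; set q := distribution P Y.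
(* An infinite alphabet makes the right side [+oo]. *)
rewrite /log_card /counting; case: asboolP => [fA|_]; last exact: leey.
set N := size _.
have N0 : (0 < N%:R :> R)%R.
  rewrite ltr0n finmap.cardfs_gt0; apply/finmap.fset0Pn; exists point.
  by rewrite in_fset_set// in_setT.
rewrite lne_EFin//.
(* The likelihood ratio of the uniform law to [q]. *)
pose rho x := (N%:R^-1 / pmass q id x)%R.
have rho0 x : (0 <= rho x)%R by rewrite divr_ge0 ?pmass_ge0// invr_ge0 ltW.
have rho1 : \int[q]_x (rho x)%:E <= 1.
  apply: le_trans (integral_div_pmass q mA id cA mA (f := fun=> N%:R^-1)%R _) _.
    by move=> _; rewrite invr_ge0 ltW.
  by rewrite esum_cst_finite// mulVf ?gt_eqF.
have irho : q.-integrable setT (EFin \o rho).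
  by apply: (ge0_integrable mA) => //; exact: le_lt_trans rho1 (ltry _).
have icst r : q.-integrable setT (EFin \o (fun=> r)).
  exact: finite_measure_integrable_cst.
have iu : q.-integrable setT (EFin \o (fun x => rho x + (ln N%:R - 1))%R).
  exact: integrable_addr.
have le x : q [set x] != 0 -> (info q id x <= rho x + (ln N%:R - 1))%R.
  move=> qx; have p0 := pmass_gt0 mA id qx.
  have : (ln (rho x) <= rho x - 1)%R.
    by apply: ln_le_subr1; rewrite divr_gt0 ?invr_gt0.
  by rewrite {1}/rho ln_div ?posrE ?invr_gt0// lnV ?posrE// /info; lra.
have ii : q.-integrable setT (EFin \o info q id).
  apply: (integrable_sandwich cA mA (icst 0%R) iu) => x qx.
  by rewrite info_ge0// le.
rewrite -[leLHS]fineK; last exact: integrable_fin_num.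
rewrite lee_fin; apply: le_trans (le_Rintegral_atoms cA mA ii iu le) _.
rewrite RintegralD// Rintegral_cst1.
by have := Rintegral_le1 rho0 rho1; lra.
Qed.

Lemma relative_entropy_self (P Q : probability A R) :
  (forall x, P [set x] = Q [set x]) -> relative_entropy P Q = 0.
Proof.
move=> PQ; rewrite relative_entropy_discrete//; last by move=> x; rewrite PQ.
apply: integral0_eq => x _; rewrite PQ.
(* At a point of mass zero the conventions [0 / 0 = 0] and [ln 0 = 0] apply. *)
have [->|q0] := eqVneq (fine (Q [set x])) 0%R; first by rewrite mul0r ln0.
by rewrite divff// ln1.
Qed.

End entropy_bounds.

Lemma card_ltn_set n c : (c <= n)%N -> #|[set i : 'I_n | (i < c)%N]%SET| = c.
Proof.
move=> cn; rewrite -sum1dep_card -(big_ord_widen _ (fun=> 1%N) cn).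
by rewrite sum1_card card_ord.
Qed.

(** * Choice of the conditioning block *)

Section exchangeable_tuple.
Context d (A : measurableType d) (R : realType) (n : nat).
Hypotheses (cA : countable [set: A]) (mA : forall F : set A, measurable F).
Variable m : probability (n.-tuple A) R.
Hypothesis m_permute : forall s F, m (permute s @^-1` F) = m F.
Hypothesis finite_entropy : forall i,
  m.-integrable setT (EFin \o info m (restr [set i])).

(** By exchangeability the block entropy is a function [G] of the block size, to which the averaging
    argument applies. The coordinate [i0] is the one whose conditional law is mixed. *)
Lemma exists_relative_entropy_le k (le_kn : (k <= n)%N) (i0 : 'I_n)
    (P : probability (k.-tuple A) R) : (i0 < k)%N ->
  (forall F, P F = m (head_tuple le_kn @^-1` F)) ->
  exists mu : probability (pprobability A R) R,
    relative_entropy P (mixture k mu) <=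
    (k%:R * (k%:R - 1) / (2 * (n%:R - k%:R + 1)) *
     block_entropy m [set i0])%R%:E.
Proof.
move=> i0k PE; pose I c : {set 'I_n} := [set i : 'I_n | (i < c)%N]%SET.
pose G c := block_entropy m (I c).
have GE (J : {set 'I_n}) c : (c <= n)%N -> #|J| = c -> block_entropy m J = G c.
  by move=> cn Jc; apply: block_entropy_card => //; rewrite card_ltn_set.
have n0 : (0 < n)%N by apply: leq_ltn_trans (ltn_ord i0).
have G1 : G 1%N = block_entropy m [set i0].
  by rewrite -(GE [set i0]%SET 1%N n0) ?cards1.
have G0 : G 0%N = 0%R by rewrite /G (_ : I 0%N = finset.set0) ?block_entropy0.
have Gle c : (G c <= G c.+1)%R.
  apply: le_block_entropy => //; apply/fintype.subsetP => i; rewrite !inE.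
  exact: ltnW.
have Gsub c : (G c.+1 <= G c + G 1%N)%R.
  (* For [c >= n] the segment [I c] is already the full index set, so [G] no longer changes. *)
  have [cn|nc] := ltnP c n; last first.
    rewrite (_ : G c.+1 = G c); first by rewrite lerDl block_entropy_ge0.
    rewrite /G; congr block_entropy; apply/finset.setP => i; rewrite !inE.
    by rewrite !(leq_trans (ltn_ord i))// ltnW.
  rewrite (_ : G c.+1 = block_entropy m (Ordinal cn |: I c)).
    rewrite (_ : G 1%N = block_entropy m [set Ordinal cn]).
      exact: block_entropyU1.
    by rewrite -(GE [set Ordinal cn]%SET 1%N n0) ?cards1.
  rewrite /G; congr block_entropy; apply/finset.setP => i.
  by rewrite !inE ltnS leq_eqVlt -val_eqE.
(* The [n - k + 1] candidate lengths [l = 0, ..., n - k] give the denominator of the bound, and each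
   satisfies [k + l <= n]. *)
have [l lnk] := exists_block_le k (n - k) G0 Gle Gsub.
have kl : (k + l <= n)%N by rewrite -(subnKC le_kn) leq_add2l.
rewrite G1 (_ : (n - k).+1%:R = n%:R - k%:R + 1 :> R)%R; last first.
  by rewrite -natr1 natrB.
(* The [l] coordinates right after the first [k], so that both together form the segment
   [I (k + l)]. *)
move=> Hl; pose Z : {set 'I_n} := [set i : 'I_n | (k <= i < k + l)%N]%SET.
have wZ i : widen_ord le_kn i \notin Z.
  by rewrite inE negb_and -ltnNge /= ltn_ord.
have i0Z : i0 \notin Z by rewrite inE negb_and -ltnNge i0k.
have KZ : ([set widen_ord le_kn i | i in 'I_k] :|: Z)%SET = I (k + l)%N.
  apply/finset.setP => i; rewrite !inE; have [ik|ki] := ltnP i k.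
    rewrite (leq_trans ik (leq_addr _ _)) orbF; apply/imsetP.
    by exists (Ordinal ik) => //; exact: val_inj.
  apply/orb_idl => /imsetP[j _ ij].
  by move: ki; rewrite ij leqNgt /= ltn_ord.
have cZ : #|Z| = l.
  have := card_ltn_set kl; rewrite -/(I _) -KZ cardsU.
  rewrite disjoint_setI0 ?cards0 ?subn0.
    rewrite card_imset ?card_ord; first by move/addnI.
    by move=> i j /(congr1 val)/= ij; apply: val_inj.
  rewrite disjoint_subset; apply/fintype.subsetP => _ /imsetP[i _ ->].
  by rewrite inE wZ.
have ln : (l < n)%N.
  by apply: leq_trans kl; rewrite -addn1 addnC leq_add2r (leq_trans _ i0k).
exists (mixing_law cA mA m i0 Z).
apply: le_trans
  (relative_entropy_mixing_law cA mA m_permute finite_entropy i0Z wZ PE) _.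
rewrite KZ -/(G _) (GE Z l (ltnW ln) cZ) lee_fin.
(* Adding one of the first [k] coordinates to [Z] always gives a block of size [l + 1], so all [k]
   terms are equal. *)
rewrite (eq_bigr (fun=> G l - G l.+1)%R) => [|i _]; last first.
  by rewrite (GE (_ |: _) l.+1)// cardsU1 wZ cZ.
rewrite sumr_const card_ord -[X in (_ - X)%R]mulr_natl.
by apply: le_trans _ Hl; lra.
Qed.

End exchangeable_tuple.

(** * From laws on tuples to random variables *)

Lemma product_power1_set1 d (A : measurableType d) (R : realType)
    (Q : probability A R) (c : 1.-tuple A) :
  measurable [set tnth c ord0] ->
  product_power Q 1 [set c] = Q [set tnth c ord0].
Proof.
move=> mc.
rewrite (_ : [set c] = [set t | forall i, [set tnth c i] (tnth t i)]).
  rewrite (@product_power_box _ _ _ _ _ (fun i => [set tnth c i])) => [|i].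
    by rewrite big_ord1.
  by rewrite (ord1 i).
by apply/seteqP; split => [t ->//|t ct]; apply: eq_from_tnth => i; exact: ct.
Qed.

Theorem corollary2p4 (R : realType)
    (dA : measure_display) (A : measurableType dA)
    (A_countable : countable [set: A])
    (A_discrete : forall F : set A, measurable F)
    (dT : measure_display) (T : measurableType dT) (P : probability T R)
    (n : nat) (X : 'I_n -> {RV P >-> A}) (X_exch : exchangeable X)
    (k : nat) (k_ge1 : (1 <= k)%N) (k_lt_n : (k < n)%N) :
  let coef : R :=
    (k%:R * (k%:R - 1) / (2 * (n%:R - k%:R + 1)))%R in
  let X1 := X (Ordinal (ltn_trans k_ge1 k_lt_n)) in
  exists mu : probability (pprobability A R) R,
    relative_entropy
      (distribution P (random_vector (initial_vars (ltnW k_lt_n) X)))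
      (mixture k mu)
      <= coef%:E * entropy X1 /\
    coef%:E * entropy X1 <= coef%:E * log_card A.
Proof.
move=> coef X1.
have coef_ge0 : (0 <= coef)%R.
  have kn : (k%:R <= n%:R :> R)%R by rewrite ler_nat ltnW.
  have k1 : (1 <= k%:R :> R)%R by rewrite ler1n.
  by apply: divr_ge0; [apply: mulr_ge0|]; lra.
(* The second inequality does not involve [mu]; it is [entropy_le_log_card] multiplied by [coef]. *)
suff [mu mu_le] : exists mu : probability (pprobability A R) R,
    relative_entropy
      (distribution P (random_vector (initial_vars (ltnW k_lt_n) X)))
      (mixture k mu) <= coef%:E * entropy X1.
  exists mu; split=> //; apply: lee_wpmul2l; first by rewrite lee_fin.
  exact: entropy_le_log_card.
pose Q1 : pprobability A R := distribution P X1.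
(* For [k = 1] the bound is [0], even with infinite entropy, since [0 * +oo = 0]. The Dirac mass at
   the law of [X1] makes the mixture equal to that law. *)
have [k1|k1] := eqVneq k 1%N.
  exists (dirac Q1).
  have [cT1 mT1] := discrete_tuple k A_countable A_discrete.
  rewrite relative_entropy_self//.
    by rewrite /coef k1 subrr mulr0 mul0r mul0e.
  subst k => c.
  rewrite [RHS](_ : _ = product_power Q1 1 [set c]); last first.
    rewrite /= /mixture integral_dirac//; first by rewrite diracT mul1e.
    exact: measurable_product_power.
  rewrite product_power1_set1//; congr (P _).
  apply/seteqP; split => w /=.
    move=> <-; rewrite tnth_mktuple; congr (X _ w); exact: val_inj.
  move=> Xw; apply: eq_from_tnth => i; rewrite (ord1 i) tnth_mktuple -Xw.
  by congr (X _ w); exact: val_inj.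
(* The argument moves to [n]-tuples under the law of the whole vector, where exchangeability is
   invariance under [permute]. *)
pose m : probability (n.-tuple A) R := distribution P (random_vector X).
have m_permute s F : m (permute s @^-1` F) = m F.
  have [_ mT] := discrete_tuple n A_countable A_discrete.
  rewrite -[RHS](X_exch s F (mT F)); congr (P _).
  apply/seteqP; split => w /=;
    rewrite (_ : permute s (random_vector X w) =
                 random_vector (fun i => X (s i)) w)//;
    by apply: eq_from_tnth => i; rewrite !tnth_mktuple.
have [cT mT] := discrete_tuple n A_countable A_discrete.
have i1P (i : 'I_n) : \int[m]_t (info m (restr [set i]) t)%:E = entropy X1.
  rewrite (integral_info_restr_card A_countable A_discrete m_permute
    (K := [set Ordinal (ltn_trans k_ge1 k_lt_n)]%SET)) ?cards1//.
  set j := Ordinal _.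
  rewrite entropy_integral//.
  rewrite (eq_measure_integral (discrete_law m mT (fun t => tnth t j)))
    => [|F _ _]; last first.
    by congr (P _); apply/seteqP; split => w /=; rewrite tnth_mktuple.
  rewrite /discrete_law [RHS]ge0_integral_distribution//; last first.
    by move=> x; rewrite lee_fin info_ge0.
  apply: eq_integral => t _; congr (- ln (fine _))%:E => /=.
  congr (P _); apply/seteqP; split => w /=.
    move=> /restrP /(_ j); rewrite inE eqxx => /(_ isT) <-.
    by rewrite tnth_mktuple.
  move=> Xw; apply/restrP => l; rewrite inE => /eqP ->.
  by rewrite -Xw tnth_mktuple.
(* Now [k >= 2], so [coef] is positive; with infinite entropy the bound is [+oo] and any [mu]
   serves. *)
have [Hoo|Hfin] := eqVneq (entropy X1) +oo.
  exists (dirac Q1); rewrite Hoo gt0_muley ?leey// lte_fin.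
  have k2 : (2%:R <= k%:R :> R)%R by rewrite ler_nat ltn_neqAle eq_sym k1.
  have kn : (k%:R <= n%:R :> R)%R by rewrite ler_nat ltnW.
  by apply: divr_gt0; [apply: mulr_gt0|]; lra.
have finite_entropy i : m.-integrable setT (EFin \o info m (restr [set i])).
  apply: (ge0_integrable mT) => [t|]; first exact: info_ge0.
  by rewrite i1P ltey.
pose i0 := Ordinal (ltn_trans k_ge1 k_lt_n).
have head_law F :
    distribution P (random_vector (initial_vars (ltnW k_lt_n) X)) F =
    m (head_tuple (ltnW k_lt_n) @^-1` F).
  congr (P _); apply/seteqP; split => w /=;
    rewrite (_ : random_vector (initial_vars (ltnW k_lt_n) X) w =
                 head_tuple (ltnW k_lt_n) (random_vector X w))//;
    by apply: eq_from_tnth => i; rewrite !tnth_mktuple.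
(* As [i0] has value [0], [k_ge1] is the required proof of [i0 < k]. *)
have [mu mu_le] := exists_relative_entropy_le A_countable A_discrete m_permute
  finite_entropy (i0 := i0) k_ge1 head_law.
exists mu; apply: le_trans mu_le _.
rewrite EFinM lee_wpmul2l ?lee_fin// -(i1P i0).
rewrite /block_entropy /Rintegral fineK//.
by apply: integrable_fin_num => //; exact: finite_entropy.
Qed.
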